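(* BigTwoDisjointSets $\le_{ql}$ BetweennessCentralityVertex.
   Context: Quasilinear reductions: for an instance $I$ let $s(I)$ be its size. A quasilinear Karp reduction from problem $\mathcal P$ to problem $\mathcal Q$ (written $\mathcal P\le_{ql}\mathcal Q$) is a function $\Phi$ from instances of $\mathcal P$ to instances of $\mathcal Q$ such that for every instance $I$ of $\mathcal P$: $\Phi(I)$ can be computed in time $\tilde O(s(I))$ (that is, $O(s(I)\log^j s(I))$ for a fixed $j$), and $I$ and $\Phi(I)$ have the same output; if the output of $\mathcal Q$ is not boolean, one additionally requires a linear-time computable function transforming the output of $\Phi(I)$ into the output of $I$. BigTwoDisjointSets: input is a finite set $X$ and a collection $\mathcal C$ of subsets of $X$ with $|X|<\log^{c}(|\mathcal C|)$ for a fixed constant $c$ (sets represented as lists); output True if there are two disjoint sets $C,C'\in\mathcal C$, False otherwise. BetweennessCentralityVertex: input is an undirected graph $G=(V,E)$ and a vertex $v\in V$; output is the betweenness centrality of $v$, namely $\sum_{s,t\in V,\ s\neq v\neq t,\ s\ne t}\frac{\sigma_{st}(v)}{\sigma_{st}}$, where $\sigma_{st}$ is the number of shortest paths from $s$ to $t$ and $\sigma_{st}(v)$ is the number of those passing through $v$. *)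

(* Defs.v *)
From HB Require Import structures.
From mathcomp Require Import all_boot all_order all_algebra.
From mathcomp Require Import reals exp.

Set Implicit Arguments.
Unset Strict Implicit.
Unset Printing Implicit Defensive.

Import Order.TTheory GRing.Theory Num.Theory.

(* Model of computation: the random access machine of Cook and Reckhow under
   the logarithmic cost criterion, with cells holding natural numbers
   (subtraction is truncated) and with structured control flow in place of
   jumps. *)

Inductive cmd : Type :=
| Skip
| Const of nat & nat          (* X_i := c *)
| Add of nat & nat & nat      (* X_i := X_j + X_k *)
| Sub of nat & nat & nat      (* X_i := X_j - X_k *)
| Fetch of nat & nat          (* X_i := X_(X_j) *)
| Store of nat & nat          (* X_(X_i) := X_j *)
| Read of nat                 (* X_i := next input number, 0 at the end *)
| Print of nat                (* append X_i to the output *)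
| Seq of cmd & cmd
| If of nat & cmd & cmd       (* tests X_i != 0 *)
| While of nat & cmd.         (* tests X_i != 0 *)

Record state : Type := State {
  inp : seq nat;
  mem : nat -> nat;
  out : seq nat }.

Definition init (w : seq nat) : state := State w (fun=> 0) [::].

Definition upd (X : nat -> nat) (i x : nat) : nat -> nat :=
  fun k => if k == i then x else X k.

Definition set_cell (s : state) (i x : nat) : state :=
  State (inp s) (upd (mem s) i x) (out s).

(* Number of binary digits, with bitlen 0 = 1. *)
Definition bitlen (n : nat) : nat := (trunc_log 2 n).+1.

Definition bitsize (w : seq nat) : nat := \sum_(x <- w) bitlen x.

(* [exec c s s' t]: started in state s, c halts in state s' at total cost t. *)
Inductive exec : cmd -> state -> state -> nat -> Prop :=
| ExecSkip s : exec Skip s s 1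
| ExecConst s i c : exec (Const i c) s (set_cell s i c) 1
| ExecAdd s i j k :
    exec (Add i j k) s (set_cell s i (mem s j + mem s k))
      (bitlen (mem s j) + bitlen (mem s k))
| ExecSub s i j k :
    exec (Sub i j k) s (set_cell s i (mem s j - mem s k))
      (bitlen (mem s j) + bitlen (mem s k))
| ExecFetch s i j :
    exec (Fetch i j) s (set_cell s i (mem s (mem s j)))
      (bitlen (mem s j) + bitlen (mem s (mem s j)))
| ExecStore s i j :
    exec (Store i j) s (set_cell s (mem s i) (mem s j))
      (bitlen (mem s i) + bitlen (mem s j))
| ExecRead s i :
    exec (Read i) s
      (State (behead (inp s)) (upd (mem s) i (head 0 (inp s))) (out s))
      (bitlen (head 0 (inp s)))
| ExecPrint s i :
    exec (Print i) s (State (inp s) (mem s) (rcons (out s) (mem s i)))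
      (bitlen (mem s i))
| ExecSeq c1 c2 s s1 s2 t1 t2 :
    exec c1 s s1 t1 -> exec c2 s1 s2 t2 -> exec (Seq c1 c2) s s2 (t1 + t2)
| ExecIfT i c1 c2 s s' t :
    mem s i != 0 -> exec c1 s s' t ->
    exec (If i c1 c2) s s' (bitlen (mem s i) + t)
| ExecIfF i c1 c2 s s' t :
    mem s i = 0 -> exec c2 s s' t ->
    exec (If i c1 c2) s s' (bitlen (mem s i) + t)
| ExecWhileT i c s s1 s2 t1 t2 :
    mem s i != 0 -> exec c s s1 t1 -> exec (While i c) s1 s2 t2 ->
    exec (While i c) s s2 (bitlen (mem s i) + t1 + t2)
| ExecWhileF i c s :
    mem s i = 0 -> exec (While i c) s s (bitlen (mem s i)).

Definition computes (c : cmd) (w w' : seq nat) (t : nat) : Prop :=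
  exists2 s, exec c (init w) s t & out s = w'.

Record problem : Type := Problem {
  instance : Type;
  encode : instance -> seq nat;
  output : Type;
  encode_output : output -> seq nat;
  answer : instance -> output }.

Definition isize (P : problem) (I : instance P) : nat := bitsize (encode I).

Definition quasilinear_time (P Q : problem)
    (Phi : instance P -> instance Q) : Prop :=
  exists c : cmd, exists K j s0 : nat, forall I : instance P,
  exists2 t, computes c (encode I) (encode (Phi I)) t
    & s0 <= isize I -> t <= K * (isize I * trunc_log 2 (isize I) ^ j).

Definition linear_time (P Q : problem) (psi : output Q -> output P) : Prop :=
  exists c : cmd, exists K : nat, forall y : output Q,
  exists2 t, computes c (encode_output y) (encode_output (psi y)) t
    & t <= K * bitsize (encode_output y).

(* Quasilinear Karp reduction to a problem Q whose output is not Boolean; for a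
   Boolean Q one would require psi to be the identity, which is not imposed
   here. *)
Definition ql_reduces (P Q : problem) : Prop :=
  exists Phi : instance P -> instance Q,
    quasilinear_time Phi /\
    exists psi : output Q -> output P,
      linear_time psi /\ forall I, psi (answer (Phi I)) = answer I.

Definition encode_bool (b : bool) : seq nat := [:: nat_of_bool b].

(* The ground set X is {0, ..., n-1}. *)

Definition set_of_list (n : nat) (C : seq 'I_n) : {set 'I_n} :=
  [set x in C].

Record set_family (R : realType) (c : R) : Type := SetFamily {
  fam_n : nat;
  fam_sets : seq (seq 'I_fam_n);
  fam_lists_uniq : all uniq fam_sets;
  fam_sets_uniq : uniq (map (@set_of_list fam_n) fam_sets);
  fam_small :
    (fam_n%:R < (ln ((size fam_sets)%:R : R) / ln 2) `^ c)%R }.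

Definition encode_family (R : realType) (c : R) (F : set_family c) : seq nat :=
  fam_n F :: iota 0 (fam_n F) ++ size (fam_sets F) ::
  flatten [seq size C :: map (@nat_of_ord _) C | C <- fam_sets F].

Definition two_disjoint_sets (R : realType) (c : R) (F : set_family c) : bool :=
  let CC := map (@set_of_list (fam_n F)) (fam_sets F) in
  [exists C in CC, exists D in CC, (C != D) && [disjoint C & D]].

Definition BigTwoDisjointSets (R : realType) (c : R) : problem :=
  Problem (@encode_family R c) encode_bool (@two_disjoint_sets R c).

Section Betweenness.
Variables (T : finType) (e : rel T).

(* Walks with k edges from s to t; the tuple lists the vertices after s. *)
Definition walks (s t : T) (k : nat) : {set k.-tuple T} :=
  [set p : k.-tuple T | path e s p && (last s p == t)].

(* The distance from s to t, and #|T| if t is not reachable from s. *)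
Definition dist (s t : T) : nat :=
  find (fun k => walks s t k != set0) (iota 0 #|T|).

(* A walk of minimal length has no repeated vertex, so these are the shortest
   paths; there are none if t is not reachable from s. *)
Definition shortest_paths (s t : T) : {set (dist s t).-tuple T} :=
  walks s t (dist s t).

Definition sigma (s t : T) : nat := #|shortest_paths s t|.

Definition sigma_through (v s t : T) : nat :=
  #|[set p in shortest_paths s t | v \in s :: p]|.

(* The sum is over ordered pairs; unreachable pairs contribute 0 / 0 = 0. *)
Definition betweenness (v : T) : rat :=
  (\sum_(s : T) \sum_(t : T | [&& s != v, v != t & s != t])
     (sigma_through v s t)%:R / (sigma s t)%:R)%R.

End Betweenness.

(* A simple undirected graph on {0, ..., n-1} with a distinguished vertex; each
   edge is listed once, in either orientation. *)
Record vgraph : Type := VGraph {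
  vg_n : nat;
  vg_edges : seq ('I_vg_n * 'I_vg_n);
  vg_vertex : 'I_vg_n;
  vg_loopless : all (fun e => e.1 != e.2) vg_edges;
  vg_edges_uniq : uniq [seq [set e.1; e.2] | e <- vg_edges] }.

Definition vg_adj (G : vgraph) : rel 'I_(vg_n G) :=
  fun x y => ((x, y) \in vg_edges G) || ((y, x) \in vg_edges G).

Definition encode_vgraph (G : vgraph) : seq nat :=
  vg_n G :: iota 0 (vg_n G) ++ nat_of_ord (vg_vertex G) ::
  flatten [seq [:: nat_of_ord e.1; nat_of_ord e.2] | e <- vg_edges G].

(* Sign, numerator and denominator of the reduced fraction. *)
Definition encode_rat (q : rat) : seq nat :=
  [:: nat_of_bool (numq q < 0)%R; absz (numq q); absz (denq q)].

Definition BetweennessCentralityVertex : problem :=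
  Problem encode_vgraph encode_rat
    (fun G => betweenness (@vg_adj G) (vg_vertex G)).

(* Main.v *)
Require Import Defs.
From mathcomp Require Import all_boot all_order all_algebra.
From mathcomp Require Import boolp reals.
From mathcomp Require Import zify.

(** Take two copies ("sides") of the incidence graph of the family, join the
    two copies of each element by an edge, attach a hub to all the set vertices
    of each side, and join the two hubs by [4m + 2] parallel paths of length
    two, where [m] is the number of sets; [v] is the middle of one of these.
    Set vertices on opposite sides are at distance 3, away from the hubs, if
    their sets meet, and at distance 4, through the hubs, otherwise. So [v]
    carries the fraction [1 / (4m + 2)] of the shortest paths exactly for the
    pairs (hub, hub), (hub, set), (set, hub) across the two sides, which are
    [4m + 2] ordered pairs in all, and for the disjoint pairs of sets. Its
    betweenness is thus 1 plus a positive multiple of the number of disjoint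
    pairs, and the output function only has to compare numerator and
    denominator. *)

Set Implicit Arguments.
Unset Strict Implicit.
Unset Printing Implicit Defensive.
Import Order.TTheory GRing.Theory Num.Theory.

(** * Shortest paths *)

Section ShortestPaths.
Variables (T : finType) (e : rel T).

(** Plain sequences, unlike tuples, can be concatenated and reversed without casts on the length. *)
Definition reach (k : nat) (s t : T) : Prop :=
  exists p, [/\ path e s p, last s p = t & size p = k].

Lemma reachP k s t : reflect (reach k s t) (walks e s t k != set0).
Proof.
apply: (iffP (set0Pn _)) => [[p]|[p [ep lp sp]]].
  by rewrite inE => /andP[ep /eqP lp]; exists p; split; rewrite ?size_tuple.
have sz : size p == k by rewrite sp.
by exists (Tuple sz); rewrite inE /= ep lp eqxx.
Qed.

Lemma dist_leq k s t : reach k s t -> dist e s t <= k.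
Proof.
move=> kst; rewrite leqNgt; apply/negP => ltk.
have ltT : k < #|T|.
  apply: leq_trans ltk _; rewrite -(size_iota 0 #|T|); exact: find_size.
have := before_find 0 ltk; rewrite nth_iota // add0n.
by move/reachP: kst => ->.
Qed.

(** The bound on [k] is there because [dist] only searches lengths below [#|T|]. *)
Lemma dist_eq k s t : k < #|T| -> reach k s t ->
  (forall j, reach j s t -> k <= j) -> dist e s t = k.
Proof.
move=> ltk kst kmin; apply/eqP; rewrite eqn_leq dist_leq //= leqNgt.
apply/negP => ltd.
have hasw : has (fun j => walks e s t j != set0) (iota 0 #|T|).
  by rewrite has_find size_iota (ltn_trans ltd).
have := nth_find 0 hasw; rewrite nth_iota; last first.
  by rewrite (ltn_trans ltd).
by rewrite add0n => /reachP /kmin; rewrite leqNgt ltd.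
Qed.

Lemma reach_cat j k s t u : reach j s t -> reach k t u -> reach (j + k) s u.
Proof.
move=> [p [ep <- <-]] [q [eq <- <-]]; exists (p ++ q).
by rewrite cat_path ep eq last_cat size_cat.
Qed.

Lemma reach_sym : symmetric e -> forall k s t, reach k s t -> reach k t s.
Proof.
move=> e_sym k s t [p [ep <- <-]]; exists (rev (belast s p)); split.
- by rewrite -(eq_path (e:=fun x y => e y x)) ?rev_path // => x y; rewrite e_sym.
- by case: p {ep} => //= y p; rewrite rev_cons last_rcons.
- by rewrite size_rev size_belast.
Qed.

Lemma sigma_through_eq0 v s t :
  (forall p, path e s p -> last s p = t -> size p = dist e s t -> v \notin s :: p) ->
  sigma_through e v s t = 0.
Proof.
move=> nov; apply/eqP; rewrite cards_eq0; apply/eqP/setP=> p.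
rewrite !inE; apply/negP=> /andP[/andP[ep /eqP lp]].
by apply/negP; rewrite -in_cons; apply: nov; rewrite ?size_tuple.
Qed.

(** In the application [M] is the type of middle vertices. A walk shorter than [k] would be some
    [g u], which has length [k]; so [k] is the distance, [g] enumerates the shortest paths, and only
    [g u0] meets [v]. *)
Lemma sigma_family (M : finType) (g : M -> seq T) (u0 : M) v k s t :
    k < #|T| -> injective g ->
    (forall u, [/\ path e s (g u), last s (g u) = t & size (g u) = k]) ->
    (forall p, path e s p -> last s p = t -> size p <= k -> exists u, p = g u) ->
    (forall u, (v \in s :: g u) = (u == u0)) ->
  sigma e s t = #|M| /\ sigma_through e v s t = 1.
Proof.
move=> ltk g_inj gP gall vP.
have szg u : size (g u) == k by have [_ _ ->] := gP u.
pose h u : k.-tuple T := Tuple (szg u).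
have h_inj : injective h by move=> u u' /(congr1 val) /g_inj.
have dk : dist e s t = k.
  apply: dist_eq => //; first by exists (g u0).
  move=> j [p [ep lp <-]]; rewrite leqNgt; apply/negP=> ltj.
  have [u pu] := gall _ ep lp (ltnW ltj).
  by move: ltj; rewrite pu (eqP (szg u)) ltnn.
have wE : walks e s t k = [set h u | u : M].
  apply/setP=> p; apply/idP/imsetP => [|[u _ ->]]; rewrite inE.
    case/andP=> ep /eqP lp; have [|u pu] := gall p ep lp.
      by rewrite size_tuple.
    by exists u => //; apply: val_inj.
  by have [-> -> _] := gP u; rewrite eqxx.
rewrite /sigma /sigma_through /shortest_paths dk wE card_imset //; split=> //.
rewrite (_ : [set p in _ | _] = [set h u0]) ?cards1 //.
apply/setP=> p; rewrite !inE; apply/andP/eqP => [[/imsetP[u _ ->]]|->].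
  by rewrite -in_cons /= vP => /eqP->.
by rewrite imset_f // -in_cons /= vP eqxx.
Qed.

End ShortestPaths.

(** * Invariance of betweenness under graph isomorphism *)

Section Isomorphism.
Variables (T T' : finType) (e : rel T) (e' : rel T') (f : T -> T').
Hypotheses (f_bij : bijective f) (f_adj : forall x y, e' (f x) (f y) = e x y).

(** With a trivial predicate this transports [sigma]; with membership of a vertex it transports
    [sigma_through]. *)
Lemma card_walks_iso (A : pred (seq T)) (A' : pred (seq T')) s t k :
    (forall p, A' (map f p) = A p) ->
  #|[set p in walks e' (f s) (f t) k | A' p]| = #|[set p in walks e s t k | A p]|.
Proof.
move=> AA'; have f_inj := bij_inj f_bij; case: (f_bij) => g fK gK.
pose h (p : k.-tuple T) := map_tuple f p.
have h_inj : injective h.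
  by move=> p q /(congr1 val) /= /(inj_map f_inj) /val_inj.
rewrite -(card_imset _ h_inj); apply: eq_card => p.
have pathE q : path e' (f s) (map f q) = path e s q.
  by rewrite path_map; apply: eq_path => x y; rewrite /= f_adj.
apply/idP/imsetP => [|[q + ->]]; rewrite !inE.
  have -> : p = h (map_tuple g p).
    by apply: val_inj; rewrite /= -map_comp map_id_in // => x _ /=; rewrite gK.
  rewrite /= pathE last_map (inj_eq f_inj) AA' => H.
  by exists (map_tuple g p); rewrite // !inE /=.
by rewrite /= pathE last_map (inj_eq f_inj) AA'.
Qed.

Lemma betweenness_iso v : betweenness e' (f v) = betweenness e v.
Proof.
have f_inj := bij_inj f_bij.
have walksI s t k : #|walks e' (f s) (f t) k| = #|walks e s t k|.
  have := @card_walks_iso xpredT xpredT s t k (fun=> erefl).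
  have andbT (U : finType) (W : {set U}) : [set p in W | true] = W.
    by apply/setP=> p; rewrite inE andbT.
  by rewrite !andbT.
have distI s t : dist e' (f s) (f t) = dist e s t.
  rewrite /dist (bij_eq_card f_bij); apply: eq_find => k.
  by rewrite -!card_gt0 walksI.
rewrite /betweenness (reindex f (onW_bij _ f_bij)) /=; apply: eq_bigr => s _.
rewrite (reindex f (onW_bij _ f_bij)) /=.
apply: eq_big => [t|t _]; first by rewrite !(inj_eq f_inj).
rewrite /sigma /sigma_through /shortest_paths distI walksI.
rewrite (@card_walks_iso (fun p => v \in s :: p) (fun p => f v \in f s :: p)) //.
by move=> p; rewrite -map_cons mem_map.
Qed.
End Isomorphism.

(** * The gadget graph *)

(** In [bool * option I], [None] is the hub of a side and [Some i] a set vertex. A hub is treated as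
    one more set, compatible with all others, so that pairs involving hubs and pairs of sets are
    handled uniformly. *)
Definition gvertex (I X M : finType) : finType :=
  ((bool * option I) + (bool * X) + M)%type.

Section Gadget.
Variables (I X M : finType) (F : I -> pred X).
Local Notation T := (gvertex I X M).

Definition side (b : bool) (o : option I) : T := inl (inl (b, o)).
Definition elt (b : bool) (x : X) : T := inl (inr (b, x)).
Definition mid (u : M) : T := inr u.
Local Notation hub b := (side b None).

Definition gadj (y z : T) : bool :=
  match y, z with
  | inl (inl (b, None)), inl (inl (b', Some _))
  | inl (inl (b, Some _)), inl (inl (b', None)) => b == b'
  | inl (inl (b, Some i)), inl (inr (b', x))
  | inl (inr (b', x)), inl (inl (b, Some i)) => (b == b') && F i x
  | inl (inr (b, x)), inl (inr (b', x')) => (b != b') && (x == x')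
  | inl (inl (_, None)), inr _ | inr _, inl (inl (_, None)) => true
  | _, _ => false
  end.

Definition meets (i j : I) : bool := [exists x, F i x && F j x].

Definition compat (o o' : option I) : bool :=
  if o is Some i then if o' is Some j then ~~ meets i j else true else true.

Definition good (s t : T) : bool :=
  match s, t with
  | inl (inl (b, o)), inl (inl (b', o')) => (b != b') && compat o o'
  | _, _ => false
  end.

Lemma gadj_sym : symmetric gadj.
Proof.
by move=> [[[b [i|]]|[b x]]|u] [[[b' [i'|]]|[b' x']]|u'] //=; rewrite eq_sym // (eq_sym x).
Qed.

(** From an element vertex a walk can only alternate between the two copies of [x] until it enters a
    set containing [x]. *)
Lemma reach_elt_hub k b b' x : reach gadj k (elt b x) (hub b') ->
  exists i, F i x.
Proof.
move=> [p [+ + _]].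
elim: p b => [|y p IHp] b //=.
case: y => [[[c [i|]]|[c z]]|u] //=.
  by move=> /andP[/andP[_ Fix] _] _; exists i.
move=> /andP[/andP[_ /eqP <-]]; exact: IHp.
Qed.

(* Hence a path through a middle vertex can be shortened unless it starts on the
   side of the first hub it meets. *)
Lemma reach_other_hub k b s : reach gadj k s (hub b) ->
  (exists o, s = side b o) \/ exists2 j, reach gadj j s (hub (~~ b)) & j <= k.+1.
Proof.
move=> sk; case: s sk => [[[c o]|[c x]]|u] sk.
- have [->|cb] := eqVneq c b; first by left; exists o.
  right; have -> : c = ~~ b by move: cb; case: (c) (b) => [] [].
  case: o {sk} => [i|]; last by exists 0 => //; exists [::].
  by exists 1 => //; exists [:: hub (~~ b)]; split; rewrite //= eqxx.
- right; have [i Fix] := reach_elt_hub sk.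
  (* On the side of [b] the walk first crosses to the other copy of [x], for length 3 in all; the
     given walk has length at least 2, since no element is adjacent to a hub. On the other side
     length 2 suffices. *)
  have [cb|cb] := eqVneq c b.
    exists 3.
      exists [:: elt (~~ b) x; side (~~ b) (Some i); hub (~~ b)].
      by split; rewrite //= !eqxx Fix cb; case: (b).
    by case: sk => [[|y [|z p]] []] //= + yE <- //; rewrite yE.
  exists 2.
    exists [:: side (~~ b) (Some i); hub (~~ b)].
    by split; rewrite //= Fix; case: b c cb {sk} => [] [].
  by case: sk => [[|y p] [] //= _ _ <-].
- by right; exists 1 => //; exists [:: hub (~~ b)].
Qed.

(** Around [mid u] the path runs from a hub [b1] to a hub [b2]. These differ, or the detour of
    length 2 could be cut out. If [s] were not on side [b1], [reach_other_hub] would reach the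
    second hub in one step less than the path does; symmetrically for [t]. Finally, sets that meet
    are joined by a walk of length 3, while a path between set vertices through [mid u] has length
    at least 4. *)
Lemma through_mid_good u s t p : s != mid u -> mid u != t ->
  path gadj s p -> last s p = t -> size p = dist gadj s t -> mid u \in p ->
  good s t.
Proof.
move=> sv vt + + + vp; case/splitPr: vp => p1 [|h2 p3].
  by rewrite last_cat /= => _ tE; rewrite -tE eqxx in vt.
rewrite cat_path last_cat size_cat /= => /and3P[ep1 eh1 /andP[eh2 ep3]] lt sz.
have min j : reach gadj j s t -> size p1 + (size p3).+2 <= j.
  by move=> /dist_leq; rewrite -sz.
have [b1 h1E] : exists b, last s p1 = hub b.
  by case: (last s p1) eh1 => [[[b [i|]]|[b x]]|v] //= _; exists b.
have [b2 h2E] : exists b, h2 = hub b.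
  by case: h2 eh2 {ep3 lt} => [[[b [i|]]|[b x]]|v] //= _; exists b.
subst h2.
have r1 : reach gadj (size p1) s (hub b1) by exists p1.
have r3 : reach gadj (size p3) (hub b2) t by exists p3.
have [b12|b12] := eqVneq b1 b2.
  by subst b2; have := min _ (reach_cat r1 r3); lia.
have b2E : b2 = ~~ b1 by case: b1 b2 b12 {h1E lt ep3 eh2 r1 r3} => [] [].
subst b2.
case: (reach_other_hub r1) => [[o so]|[j rj lej]]; last first.
  by have := min _ (reach_cat rj r3); lia.
have r3' := reach_sym gadj_sym r3.
case: (reach_other_hub r3') => [[o' to]|[j]]; last first.
  rewrite negbK => /(reach_sym gadj_sym) rj lej.
  by have := min _ (reach_cat r1 rj); lia.
rewrite so to /= b12 /=; case: o o' so to => [i|] [i'|] //= so to.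
apply/negP=> /existsP[x /andP[Fi Fi']].
have: reach gadj 3 s t.
  exists [:: elt b1 x; elt (~~ b1) x; t].
  by rewrite so to; split; rewrite //= !eqxx Fi Fi' b12.
have: 0 < size p1 by case: (p1) h1E; rewrite // so.
have: 0 < size p3 by case: (p3) lt; rewrite // to.
by move=> ? ? /min; lia.
Qed.

Definition midpath (b : bool) (o o' : option I) (u : M) : seq T :=
  (if o is Some _ then [:: hub b] else [::]) ++
  mid u :: hub (~~ b) :: (if o' is Some _ then [:: side (~~ b) o'] else [::]).

Ltac walk_cases :=
  move=> + [] *; subst=> //=;
  repeat match goal with
  | |- is_true (_ && _) -> _ => case/andP
  | |- is_true (_ == _) -> _ => move/eqP=> ?; subst
  | |- is_true _ -> _ => move=> ?
  end.

Lemma short_walk_midpath b o o' p : compat o o' ->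
  path gadj (side b o) p -> last (side b o) p = side (~~ b) o' ->
  size p <= o + o' + 2 -> exists u, p = midpath b o o' u.
Proof.
case: o o' => [i|] [j|] oo'.
(* The length is at most 4, so five case distinctions exhaust the walk, including the impossible
   fifth vertex. *)
all: do 5 try (case: p => [|[[[? [?|]]|[? ?]]|?] p] //=); rewrite ?andbF //.
all: walk_cases.
all: try by eexists.
all: try by case: (b).
all: try match goal with H : ?a = ~~ ?a |- _ => by case: (a) H end.
all: try match goal with H : ~~ ?a = ?a |- _ => by case: (a) H end.
(* What remains are the walks of length 3 between set vertices through both copies of some [x], an
   element of both sets. *)
all: case/negP: oo'; apply/existsP.
all: match goal with H : is_true (F _ ?x) |- _ => exists x end.
all: by apply/andP.
Qed.

Lemma sigma_good u b o o' : 4 < #|T| -> compat o o' ->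
  sigma gadj (side b o) (side (~~ b) o') = #|M| /\
  sigma_through gadj (mid u) (side b o) (side (~~ b) o') = 1.
Proof.
move=> T4 oo'.
apply: (@sigma_family _ _ _ (midpath b o o') u _ (o + o' + 2)).
(* The distance is at most 4, hence within the range searched by [dist]. *)
- by case: (o) (o') => [?|] [?|]; apply: leq_ltn_trans T4.
- by case: o oo' => [i|] _ v v' [].
- by move=> v; case: (o) (o') => [i|] [j|]; split; rewrite //= ?eqxx.
- by move=> p; apply: short_walk_midpath.
- move=> v; rewrite !inE mem_cat !inE.
  have -> : (mid u == mid v) = (v == u) by rewrite eq_sym; apply/eqP/eqP => [[]|->].
  by case: (o) (o') => [?|] [?|]; rewrite /= ?inE ?orbF.
Qed.

Lemma contribution u s t : 4 < #|T| -> s != mid u -> mid u != t ->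
  ((sigma_through gadj (mid u) s t)%:R / (sigma gadj s t)%:R =
   (good s t)%:R / #|M|%:R :> rat)%R.
Proof.
move=> T4 su ut; case: (boolP (good s t)) => [|bad].
  case: s t {su ut} => [[[b o]|?]|?] // [[[b' o']|?]|?] //= /andP[bb' oo'].
  have {bb'}-> : b' = ~~ b by case: b b' bb' => [] [].
  by have [-> ->] := sigma_good u b T4 oo'.
rewrite sigma_through_eq0 ?mul0r // => p ep lp szp.
rewrite inE eq_sym negb_or su /=; apply: contra bad => up.
exact: through_mid_good su ut ep lp szp up.
Qed.

Lemma sum_option (f : option I -> nat) : \sum_o f o = f None + \sum_i f (Some i).
Proof.
by rewrite ![index_enum _]unlock [@Finite.enum in LHS]unlock /= big_cons big_map.
Qed.

(** The factor 2 is the choice of the side of [s]. For a given side, [1] counts the pair of hubs and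
    [2 * #|I|] the pairs of a hub and a set, in either order. *)
Lemma sum_good : \sum_s \sum_t good s t =
  2 * (2 * #|I| + 1 + \sum_i \sum_j ~~ meets i j).
Proof.
transitivity (\sum_(p : bool * option I) \sum_(q : bool * option I)
    ((p.1 != q.1) && compat p.2 q.2)).
  rewrite 2!big_sumType /= [X in _ + _ + X]big1 => [|s _]; last first.
    by rewrite big1.
  rewrite [X in _ + X + _]big1 => [|[b x] _]; last by rewrite big1.
  rewrite !addn0; apply: eq_bigr => -[b o] _.
  rewrite 2!big_sumType /= [X in _ + _ + X]big1 // [X in _ + X + _]big1 ?addn0.
    by apply: eq_bigr => -[b' o'].
  by case.
have compat_sum : \sum_o \sum_o' compat o o' =
    2 * #|I| + 1 + \sum_i \sum_j ~~ meets i j.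
  rewrite !sum_option /= !sum1_card.
  under [X in _ + X]eq_bigr => i _ do rewrite sum_option /=.
  rewrite big_split /= sum1_card.
  have -> : #|(xpredT : pred I)| = #|I| by apply: eq_card.
  by set D := \sum_i _; lia.
rewrite -(pair_bigA _ (fun b o => \sum_(q : bool * option I) (b != q.1) && compat o q.2)).
under eq_bigr => b _ do under eq_bigr => o _ do
  rewrite -(pair_bigA _ (fun b' o' => nat_of_bool ((b != b') && compat o o'))) big_bool /=.
rewrite big_bool /= -compat_sum mul2n -addnn; congr (_ + _); apply: eq_bigr => o _.
  by rewrite big1.
by rewrite [X in _ + X]big1 ?addn0.
Qed.

Lemma gadget_betweenness u : 4 < #|T| ->
  betweenness gadj (mid u) =
  ((2 * (2 * #|I| + 1 + \sum_i \sum_j ~~ meets i j))%:R / #|M|%:R)%R.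
Proof.
move=> T4; rewrite -sum_good natr_sum mulr_suml /betweenness.
apply: eq_bigr => s _; rewrite natr_sum mulr_suml.
(* Good pairs consist of distinct vertices, neither of them a middle vertex, so the side conditions
   in the definition of betweenness lose none of them. *)
rewrite [RHS](bigID (fun t => [&& s != mid u, mid u != t & s != t])) /=.
rewrite [X in (_ + X)%R]big1 ?addr0 => [|t bad].
  by apply: eq_bigr => t /and3P[su ut _]; apply: contribution.
suff /negbTE-> : ~~ good s t by rewrite mul0r.
apply: contra bad.
case: s t => [[[b o]|?]|?] // [[[b' o']|?]|?] //= /andP[bb' _].
by apply: contra bb' => /eqP[->].
Qed.
End Gadget.

(** * The graph of a set family *)

Section Numbering.
Variables (n m : nat) (L : 'I_m -> seq 'I_n.+1).
Local Notation I := 'I_m.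
Local Notation X := 'I_n.+1.
Local Notation M := 'I_(4 * m).+2.
Local Notation T := (gvertex I X M).

(** There are [2 * (m + 1)] hubs and sets, [2 * (n + 1)] elements with the padding one, and
    [4 * m + 2] middle vertices. *)
Definition graph_order := 6 * m + 2 * n + 6.

(** Each class of vertices fills an interval, and the two copies of a vertex get consecutive
    numbers, so that the program can generate the codes with running counters. The hubs are 0 and
    1. *)
Definition code (y : T) : nat :=
  match y with
  | inl (inl (b, o)) => 2 * (if o is Some i then (i : nat).+1 else 0) + b
  | inl (inr (b, x)) => 2 * m + 2 + 2 * x + b
  | inr u => 2 * m + 2 * n + 4 + u
  end.

Lemma code_lt y : code y < graph_order.
Proof.
rewrite /graph_order; case: y => [[[b [i|]]|[b x]]|u] /=.
- by case: b; have := ltn_ord i; lia.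
- by case: b; lia.
- by case: b; have := ltn_ord x; lia.
- by have := ltn_ord u; lia.
Qed.

Lemma code_inj : injective code.
Proof.
have half2 a b (c d : bool) : 2 * a + c = 2 * b + d -> a = b /\ c = d.
  by case: c d => [] [] ?; split; lia.
move=> [[[b o]|[b x]]|u] [[[b' o']|[b' x']]|u'] /=.
- case/half2 => + ->; case: o o' => [i|] [i'|] //=.
  by case=> ii; congr (inl (inl (_, Some _))); apply: val_inj.
- by case: o => [i|]; [have := ltn_ord i|]; case: b b' => [] []; lia.
- by case: o => [i|]; [have := ltn_ord i|]; case: b => []; lia.
- by case: o' => [i|]; [have := ltn_ord i|]; case: b b' => [] []; lia.
- move=> E; have /half2 [xx' ->] : 2 * x + b = 2 * x' + b' by lia.
  by congr (inl (inr (_, _))); apply: val_inj.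
- by have := ltn_ord x; case: b => []; lia.
- by case: o' => [i|]; [have := ltn_ord i|]; case: b' => []; lia.
- by have := ltn_ord x'; case: b' => []; lia.
- by move=> E; congr inr; apply: val_inj => /=; lia.
Qed.

Definition vertex (y : T) : 'I_graph_order := Ordinal (code_lt y).

Lemma vertex_inj : injective vertex.
Proof. by move=> y z /(congr1 val) /code_inj. Qed.

Lemma card_gadget : #|T| = graph_order.
Proof.
by rewrite !card_sum !card_prod card_bool card_option !card_ord /graph_order; lia.
Qed.

Lemma vertex_bij : bijective vertex.
Proof. by apply: inj_card_bij vertex_inj _; rewrite card_gadget card_ord. Qed.

Definition set_edge (i : I) (p : option X * bool) : T * T :=
  if p.1 is Some x then (side _ _ p.2 (Some i), elt _ _ p.2 x)
  else (side _ _ p.2 None, side _ _ p.2 (Some i)).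

(** The edges are listed in the order in which the program prints them. *)
Definition mid_edges : seq (T * T) :=
  [seq (side _ _ b None, mid _ _ u) | u <- enum M, b <- [:: false; true]].
Definition elt_edges : seq (T * T) :=
  [seq (elt _ _ false x, elt _ _ true x) | x <- enum X].
Definition set_edges : seq (T * T) :=
  [seq set_edge i p | i <- enum I,
                      p <- [seq (o, b) | o <- None :: map Some (L i), b <- [:: false; true]]].
Definition edges : seq (T * T) := mid_edges ++ elt_edges ++ set_edges.

Lemma mem_bools b : b \in [:: false; true]. Proof. by case: b. Qed.

Lemma mem_mid_edges y z : (y, z) \in mid_edges =
  match y, z with inl (inl (_, None)), inr _ => true | _, _ => false end.
Proof.
apply/allpairsP/idP => [[[u b] [_ _ [-> ->]]] //|].
case: y z => [[[b [i|]]|[b x]]|u] // [[?|?]|u] // _.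
by exists (u, b); split; rewrite ?mem_enum ?mem_bools.
Qed.

Lemma mem_elt_edges y z : (y, z) \in elt_edges =
  match y, z with
  | inl (inr (b, x)), inl (inr (b', x')) => [&& ~~ b, b' & x == x']
  | _, _ => false end.
Proof.
apply/mapP/idP => [[x _ [-> ->]]|]; first by rewrite /= eqxx.
case: y z => [[[b [i|]]|[b x]]|u] // [[?|[b' x']]|?] //.
by case/and3P=> /negbTE-> -> /eqP <-; exists x; rewrite ?mem_enum.
Qed.

Lemma mem_set_edges y z : (y, z) \in set_edges =
  match y, z with
  | inl (inl (b, None)), inl (inl (b', Some _)) => b == b'
  | inl (inl (b, Some i)), inl (inr (b', x)) => (b == b') && (x \in L i)
  | _, _ => false end.
Proof.
apply/allpairsPdep/idP => [[i [[o b] [_ /allpairsP[[o' b'] [/= o'L _ [-> ->]]]]]]|].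
  by move: o'L; rewrite inE => /orP[/eqP->|/mapP[x xL ->]] [-> ->] /=; rewrite eqxx.
case: y z => [[[b [i|]]|[b x]]|u] // [[[b' [i'|]]|[b' x']]|u'] //.
  case/andP => /eqP<- xL; exists i, (Some x', b); split; rewrite ?mem_enum //.
  apply/allpairsP; exists (Some x', b).
  by split; rewrite ?mem_bools //= inE map_f.
move/eqP<-; exists i', (None, b); split; rewrite ?mem_enum //.
apply/allpairsP; exists (None, b); split; rewrite ?mem_bools //.
Qed.

Lemma gadj_edges y z :
  gadj (fun i x => x \in L i) y z = ((y, z) \in edges) || ((z, y) \in edges).
Proof.
rewrite !mem_cat !mem_mid_edges !mem_elt_edges !mem_set_edges.
case: y z => [[[b [i|]]|[b x]]|u] [[[b' [i'|]]|[b' x']]|u'] //=;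
  rewrite ?orbF //.
by rewrite (eq_sym x'); case: b b' => [] [] //=; rewrite ?orbF.
Qed.

(** Since every edge is listed with its smaller end first, there are no loops and no edge appears in
    both orientations. *)
Lemma edges_code_lt e : e \in edges -> code e.1 < code e.2.
Proof.
case: e => y z; rewrite !mem_cat mem_mid_edges mem_elt_edges mem_set_edges.
case: y z => [[[b [i|]]|[b x]]|u] [[[b' [i'|]]|[b' x']]|u'] //=.
- by case/andP=> /eqP-> _; have := ltn_ord i; case: b'; lia.
- by move => /eqP->; lia.
- by case: b => _; lia.
- by rewrite orbF => /and3P[/negbTE-> -> /eqP->] /=; lia.
Qed.

Lemma edges_uniq : (forall i, uniq (L i)) -> uniq edges.
Proof.
move=> Lu; rewrite !cat_uniq; apply/and4P; split=> //.
- apply: allpairs_uniq; rewrite ?enum_uniq //.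
  by move=> [u b] [u' b'] _ _ [-> ->].
- apply/hasPn => -[y z]; rewrite mem_cat mem_elt_edges mem_set_edges /= mem_mid_edges.
  by case: y z => [[[b [i|]]|[b x]]|u] [[[b' [i'|]]|[b' x']]|u'].
- by rewrite map_inj_uniq ?enum_uniq // => x y [].
apply/andP; split.
  apply/hasPn => -[y z]; rewrite mem_elt_edges /= mem_set_edges.
  by case: y z => [[[b [i|]]|[b x]]|u] [[[b' [i'|]]|[b' x']]|u'].
apply: allpairs_uniq_dep; rewrite ?enum_uniq //.
  move=> i _; apply: allpairs_uniq => //; last by move=> [o b] [o' b'] _ _ [-> ->].
  rewrite /= map_inj_uniq ?Lu ?andbT; last by move=> x y [].
  by apply/mapP=> -[].
by move=> [i [[x|] b]] [i' [[x'|] b']] _ _ //= [] *; subst.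
Qed.

Hypothesis L_uniq : forall i, uniq (L i).

Definition vedges : seq ('I_graph_order * 'I_graph_order) :=
  [seq (vertex e.1, vertex e.2) | e <- edges].

Lemma vedges_lt e : e \in vedges -> e.1 < e.2.
Proof. by case/mapP => e' /edges_code_lt ? ->. Qed.

Lemma vedges_loopless : all (fun e => e.1 != e.2) vedges.
Proof. by apply/allP => e /vedges_lt; rewrite ltn_neqAle => /andP[]. Qed.

Lemma vedges_uniq : uniq [seq [set e.1; e.2] | e <- vedges].
Proof.
rewrite map_inj_in_uniq; last first.
  (* Two increasing pairs with the same underlying set are equal. *)
  move=> [a b] [c d] /vedges_lt /= ab /vedges_lt /= cd /setP E.
  have := E a; have := E b; have := E c; rewrite !inE !eqxx /= ?orbT.
  move=> /orP[]/eqP ? /esym /orP[]/eqP ? /esym /orP[]/eqP ?; subst=> //; lia.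
rewrite map_inj_uniq ?edges_uniq // => -[a b] [c d] /= [].
by move=> /code_inj -> /code_inj ->.
Qed.

Definition reduction : vgraph :=
  @VGraph graph_order vedges (vertex (mid _ _ ord0)) vedges_loopless vedges_uniq.

Lemma reduction_betweenness :
  betweenness (@vg_adj reduction) (vg_vertex reduction) =
  ((2 * (2 * m + 1 + \sum_i \sum_j ~~ meets (fun i x => x \in L i) i j))%:R
     / (4 * m).+2%:R)%R.
Proof.
rewrite (@betweenness_iso _ _ (gadj (fun i x => x \in L i)) _ vertex vertex_bij).
  by rewrite gadget_betweenness ?card_ord // card_gadget /graph_order; lia.
move=> y z; rewrite gadj_edges /vg_adj /= /vedges.
have inj : injective (fun e : T * T => (vertex e.1, vertex e.2)).
  by move=> -[a b] [c d] [] /code_inj -> /code_inj ->.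
by rewrite -!(mem_map inj).
Qed.

Lemma reduction_betweenness_gt1 :
  (1 < betweenness (@vg_adj reduction) (vg_vertex reduction))%R =
  [exists i, exists j, ~~ meets (fun i x => x \in L i) i j].
Proof.
rewrite reduction_betweenness ltr_pdivlMr ?ltr0n // mul1r ltr_nat.
set D := \sum_i _.
(* The number of middle vertices was chosen equal to the contribution [2 * (2 * m + 1)] of the pairs
   with a hub, which puts the threshold at 1. *)
have -> : ((4 * m).+2 < 2 * (2 * m + 1 + D)) = (0 < D) by lia.
apply/idP/existsP => [|[i /existsP[j nij]]]; last first.
  rewrite /D (bigD1 i) // addn_gt0 /=; apply/orP; left.
  by rewrite (bigD1 j) // addn_gt0 lt0b; apply/orP; left.
move=> D_gt0; apply/existsP; apply: contraTT D_gt0 => /existsPn noD.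
rewrite /D big1 // => i _; rewrite big1 // => j _.
by have /existsPn/(_ j) := noD i; rewrite negbK => ->.
Qed.
End Numbering.

(** * Padding the empty set *)

Section Padding.
Variable n : nat.

(* The extra element [n] makes the empty set meet itself and nothing else, so
   that a set is never disjoint from its own copy on the other side. *)
Definition padded (s : seq 'I_n) : seq 'I_n.+1 :=
  if s is [::] then [:: ord_max] else map (widen_ord (leqnSn n)) s.

Lemma widen_inj : injective (widen_ord (leqnSn n)).
Proof. by move=> x y /(congr1 val) /= xy; apply: val_inj. Qed.

Lemma padded_uniq s : uniq s -> uniq (padded s).
Proof. by case: s => // x s xs; rewrite map_inj_uniq //; apply: widen_inj. Qed.

Variable ss : seq (seq 'I_n).
Hypothesis ss_uniq : uniq (map (@set_of_list n) ss).
Local Notation L := (fun i : 'I_(size ss) => padded (nth [::] ss i)).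
Local Notation S i := (set_of_list (nth [::] ss i)).

Lemma set_of_nth_inj (i j : 'I_(size ss)) : S i = S j -> i = j.
Proof.
move=> Sij; apply: ord_inj; apply/eqP.
rewrite -(@nth_uniq _ set0 (map (@set_of_list n) ss)) ?size_map //.
by rewrite !(nth_map [::]) // Sij.
Qed.

(** Padded lists are nonempty, so each meets itself. Padding changes only the empty set, which
    occurs at most once in the family, and the new element lies in no other set. *)
Lemma padded_disjoint (i j : 'I_(size ss)) :
  ~~ meets (fun i x => x \in L i) i j = (i != j) && [disjoint S i & S j].
Proof.
apply/idP/andP => [/existsPn nij|[ij /pred0P dij]].
  split; last first.
    apply/pred0P => x; apply/negbTE; rewrite /= !inE.
    have := nij (widen_ord (leqnSn n) x).
    case: (nth [::] ss i) => // y s; case: (nth [::] ss j) => [|z s'] //.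
      by rewrite andbF.
    by rewrite /padded !mem_map //; apply: widen_inj.
  apply/negP=> /eqP ij; subst j.
  have := nij (head ord_max (padded (nth [::] ss i))).
  by case: (nth [::] ss i) => [|y s] /=; rewrite ?inE !eqxx.
apply/existsPn => x; apply/negP => /andP[].
have := @set_of_nth_inj i j; move: dij.
case: (nth [::] ss i) => [|y s]; case: (nth [::] ss j) => [|z s'] dij inj.
- by rewrite inj ?eqxx in ij.
- rewrite inE => /eqP-> /mapP[w _ /(congr1 val)] /= nw.
  by have := ltn_ord w; rewrite -nw ltnn.
- move=> /mapP[w _ ->]; rewrite inE => /eqP /(congr1 val) /= nw.
  by have := ltn_ord w; rewrite nw ltnn.
- move=> /mapP[w ws ->]; rewrite /padded mem_map; last exact: widen_inj.
  by move=> ws'; have := dij w; rewrite /= !inE -!in_cons ws ws'.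
Qed.

Lemma padded_two_disjoint :
  [exists i, exists j, ~~ meets (fun i x => x \in L i) i j] =
  let CC := map (@set_of_list n) ss in
  [exists C in CC, exists D in CC, (C != D) && [disjoint C & D]].
Proof.
apply/existsP/existsP => [[i /existsP[j]]|[C /andP[/(nthP set0)[i]]]].
  rewrite padded_disjoint => /andP[ij dij]; exists (S i).
  rewrite map_f ?mem_nth //=; apply/existsP; exists (S j).
  rewrite map_f ?mem_nth //= dij andbT.
  by apply: contra ij => /eqP/set_of_nth_inj->.
rewrite size_map => lti; rewrite (nth_map [::]) // => <-.
case/existsP=> D /andP[/(nthP set0)[j]].
rewrite size_map => ltj; rewrite (nth_map [::]) // => <- /andP[nij dij].
exists (Ordinal lti); apply/existsP; exists (Ordinal ltj).
rewrite padded_disjoint dij andbT; apply: contra nij => /eqP[/= ->].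
exact: eqxx.
Qed.
End Padding.

(** * The reduction and its correctness *)

Section Family.
Variables (R : realType) (c : R).
Implicit Types (F : set_family c).

Lemma padded_family_uniq F (i : 'I_(size (fam_sets F))) :
  uniq (padded (nth [::] (fam_sets F) i)).
Proof. by apply: padded_uniq; apply: (allP (fam_lists_uniq F)); apply: mem_nth. Qed.

Definition family_graph F : vgraph := reduction (@padded_family_uniq F).

(** Comparing absolute values decides whether [q] exceeds 1 for nonnegative [q], and betweenness is
    nonnegative. *)
Definition exceeds1 (q : rat) : bool := absz (denq q) < absz (numq q).

Lemma exceeds1E q : (0 <= q)%R -> exceeds1 q = (1 < q)%R.
Proof.
move=> q0; rewrite -[in RHS](divq_num_den q) ltr_pdivlMr ?ltr0z ?denq_gt0 //.
rewrite mul1r ltr_int /exceeds1 -ltz_nat !gez0_abs ?numq_ge0 ?denq_ge0 //.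
Qed.

Lemma family_graph_correct F :
  exceeds1 (answer (p := BetweennessCentralityVertex) (family_graph F)) =
  two_disjoint_sets F.
Proof.
rewrite exceeds1E.
  by rewrite /= reduction_betweenness_gt1 padded_two_disjoint ?fam_sets_uniq.
by rewrite /= reduction_betweenness divr_ge0 ?ler0n.
Qed.
End Family.

(** * The random access machine program *)

(** Memory as a finite list of registers lets simplification compute the successive states. *)
Definition regs (w r o : seq nat) : state := State w (nth 0 r) o.

Lemma upd_nth r i x : upd (nth 0 r) i x = nth 0 (set_nth 0 r i x).
Proof. by apply/funext => k; rewrite /upd nth_set_nth. Qed.

Lemma leq_bitlen x y : x <= y -> bitlen x <= bitlen y.
Proof. by move=> xy; rewrite ltnS leq_trunc_log. Qed.

Section Runs.
Variable V : nat.

(* All numbers handled are at most [V], so [k] elementary accesses cost at most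
   [k * bitlen V]. *)
Definition runs (c : cmd) (s s' : state) (k : nat) : Prop :=
  exists2 t, exec c s s' t & t <= k * bitlen V.

(** The equation [s1 = s'] allows the final state to be found by unification and compared with the
    expected one afterwards. *)
Lemma runs_weaken c s s1 s' k k' :
  runs c s s1 k -> s1 = s' -> k <= k' -> runs c s s' k'.
Proof.
move=> [t ct tk] <- kk'; exists t => //.
by apply: leq_trans tk _; rewrite leq_mul2r kk' orbT.
Qed.

Lemma runs_skip s : runs Skip s s 1.
Proof. by exists 1; [exact: ExecSkip | rewrite mul1n]. Qed.

Lemma runs_seq c1 c2 s s1 s2 k1 k2 :
  runs c1 s s1 k1 -> runs c2 s1 s2 k2 -> runs (Seq c1 c2) s s2 (k1 + k2).
Proof.
move=> [t1 c1t t1k] [t2 c2t t2k]; exists (t1 + t2); first exact: ExecSeq c1t c2t.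
by rewrite mulnDl leq_add.
Qed.

Lemma runs_const w r o i x :
  runs (Const i x) (regs w r o) (regs w (set_nth 0 r i x) o) 1.
Proof.
exists 1; last by rewrite mul1n.
by rewrite /regs -upd_nth; apply: (ExecConst (regs w r o)).
Qed.

Lemma runs_add w r o i j k : nth 0 r j <= V -> nth 0 r k <= V ->
  runs (Add i j k) (regs w r o)
    (regs w (set_nth 0 r i (nth 0 r j + nth 0 r k)) o) 2.
Proof.
move=> jV kV; exists (bitlen (nth 0 r j) + bitlen (nth 0 r k)).
  by rewrite /regs -upd_nth; apply: (ExecAdd (regs w r o)).
by rewrite mul2n -addnn leq_add ?leq_bitlen.
Qed.

Lemma runs_sub w r o i j k : nth 0 r j <= V -> nth 0 r k <= V ->
  runs (Defs.Sub i j k) (regs w r o)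
    (regs w (set_nth 0 r i (nth 0 r j - nth 0 r k)) o) 2.
Proof.
move=> jV kV; exists (bitlen (nth 0 r j) + bitlen (nth 0 r k)).
  by rewrite /regs -upd_nth; apply: (ExecSub (regs w r o)).
by rewrite mul2n -addnn leq_add ?leq_bitlen.
Qed.

Lemma runs_read x w r o i : x <= V ->
  runs (Read i) (regs (x :: w) r o) (regs w (set_nth 0 r i x) o) 1.
Proof.
move=> xV; exists (bitlen x); last by rewrite mul1n leq_bitlen.
by rewrite /regs -upd_nth; apply: (ExecRead (regs (x :: w) r o)).
Qed.

Lemma runs_print w r o i : nth 0 r i <= V ->
  runs (Print i) (regs w r o) (regs w r (o ++ [:: nth 0 r i])) 1.
Proof.
move=> iV; exists (bitlen (nth 0 r i)); last by rewrite mul1n leq_bitlen.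
by rewrite cats1; apply: (ExecPrint (regs w r o)).
Qed.

Lemma runs_if_true i c1 c2 w r o s k : nth 0 r i != 0 -> nth 0 r i <= V ->
  runs c1 (regs w r o) s k -> runs (If i c1 c2) (regs w r o) s k.+1.
Proof.
move=> i0 iV [t ct tk]; exists (bitlen (nth 0 r i) + t).
  exact: (@ExecIfT i c1 c2 (regs w r o)).
by rewrite mulSn leq_add ?leq_bitlen.
Qed.

Lemma runs_if_false i c1 c2 w r o s k : nth 0 r i = 0 ->
  runs c2 (regs w r o) s k -> runs (If i c1 c2) (regs w r o) s k.+1.
Proof.
move=> i0 [t ct tk]; exists (bitlen (nth 0 r i) + t).
  exact: (@ExecIfF i c1 c2 (regs w r o)).
by rewrite mulSn leq_add ?leq_bitlen ?i0.
Qed.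

Lemma runs_while_true i c w r o s s' k k' : nth 0 r i != 0 -> nth 0 r i <= V ->
  runs c (regs w r o) s k -> runs (While i c) s s' k' ->
  runs (While i c) (regs w r o) s' (k + k').+1.
Proof.
move=> i0 iV [t ct tk] [t' ct' tk'].
exists (bitlen (nth 0 r i) + t + t').
  exact: (@ExecWhileT i c (regs w r o)) ct ct'.
by rewrite mulSn mulnDl -addnA !leq_add ?leq_bitlen.
Qed.

Lemma runs_while_false i c w r o : nth 0 r i = 0 ->
  runs (While i c) (regs w r o) (regs w r o) 1.
Proof.
move=> i0; exists (bitlen (nth 0 r i)); first exact: (@ExecWhileF i c (regs w r o)).
by rewrite mul1n leq_bitlen ?i0.
Qed.
End Runs.

(** The first three registers hold constants. [XB] and [MB] hold the first codes of the element and
    middle vertices, [MC] the number of middle vertices. [CNT] counts down the loops, [CUR] is the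
    current code and [NXT] its copy on the other side, [SZ] the number of members still to be read,
    and [Y] is scratch. *)
Local Notation ZERO := 0 (only parsing).
Local Notation ONE := 1 (only parsing).
Local Notation TWO := 2 (only parsing).
Local Notation N := 3 (only parsing).
Local Notation M := 4 (only parsing).
Local Notation CNT := 5 (only parsing).
Local Notation CUR := 6 (only parsing).
Local Notation XB := 7 (only parsing).
Local Notation MB := 8 (only parsing).
Local Notation MC := 9 (only parsing).
Local Notation SZ := 10 (only parsing).
Local Notation NXT := 11 (only parsing).
Local Notation Y := 12 (only parsing).

Definition block (cs : seq cmd) : cmd := foldr Seq Skip cs.

Definition skip_loop : cmd := While CNT (block [:: Read Y; Defs.Sub CNT CNT ONE]).

Definition iota_loop : cmd :=
  While CNT (block [:: Print CUR; Add CUR CUR ONE; Defs.Sub CNT CNT ONE]).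

Definition mid_loop : cmd :=
  While CNT (block [:: Print ZERO; Print CUR; Print ONE; Print CUR;
                       Add CUR CUR ONE; Defs.Sub CNT CNT ONE]).

Definition elt_loop : cmd :=
  While CNT (block [:: Print CUR; Add CUR CUR ONE; Print CUR; Add CUR CUR ONE;
                       Defs.Sub CNT CNT ONE]).

Definition emit_elt : seq cmd :=
  [:: Add Y Y Y; Add Y Y XB; Print CUR; Print Y;
      Add Y Y ONE; Print NXT; Print Y].

Definition member_loop : cmd :=
  While SZ (block (Read Y :: emit_elt ++ [:: Defs.Sub SZ SZ ONE])).

(** The second branch of the test on [SZ] supplies the padding element [n] to an empty set. *)
Definition set_loop : cmd :=
  While CNT (block
    [:: Read SZ; Add NXT CUR ONE; Print ZERO; Print CUR; Print ONE; Print NXT;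
        If SZ member_loop (block (Add Y N ZERO :: emit_elt));
        Add CUR CUR TWO; Defs.Sub CNT CNT ONE]).

(** One pass over the input suffices: edges are printed as soon as a set or a member is read, and no
    list is stored. The number of instructions is therefore linear in the length of the input. *)
Definition reduction_prog : cmd := block
  [:: Const ONE 1; Const TWO 2; Read N; Add CNT N ZERO; skip_loop; Read M;
      Add XB M M; Add XB XB TWO;
      Add MB N N; Add MB MB TWO; Add MB MB XB;
      Add MC M M; Add MC MC MC; Add MC MC TWO;
      Add CNT MB MC; Print CNT; iota_loop;
      Print MB;
      Add CNT MC ZERO; Add CUR MB ZERO; mid_loop;
      Add CNT N ONE; Add CUR XB ZERO; elt_loop;
      Add CNT M ZERO; Add CUR TWO ZERO; set_loop].

(** The recursion follows the counter of the program; [elt_codesE] gives the closed form needed to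
    compare with the graph. *)
Fixpoint elt_codes (cur k : nat) : seq nat :=
  if k is k'.+1 then [:: cur; cur.+1] ++ elt_codes cur.+2 k' else [::].

Definition mid_codes (cur k : nat) : seq nat :=
  flatten [seq [:: 0; j; 1; j] | j <- iota cur k].

Definition member_codes (xb cur : nat) (s : seq nat) : seq nat :=
  flatten [seq [:: cur; xb + 2 * x; cur.+1; (xb + 2 * x).+1] | x <- s].

Definition pad (n : nat) (s : seq nat) : seq nat :=
  if s is [::] then [:: n] else s.

Fixpoint set_codes (n xb cur : nat) (ss : seq (seq nat)) : seq nat :=
  if ss is s :: ss' then
    [:: 0; cur; 1; cur.+1] ++ member_codes xb cur (pad n s) ++
    set_codes n xb cur.+2 ss'
  else [::].

Ltac op := first
  [ eapply runs_const | eapply runs_add | eapply runs_sub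
  | eapply runs_read | eapply runs_print | eapply runs_skip ].

Ltac step := eapply runs_seq; [ by op; rewrite /=; lia | rewrite /= ].

Ltac steps := rewrite /block /=; do ? step; apply: runs_skip.
(** After one execution of the body, three goals are left: the remaining iterations, the equality of
    the final states, and the cost. *)
Ltac loop_body := eapply runs_weaken;
  [ eapply runs_while_true; [ by [] | by rewrite /=; lia | by steps | ] | | ].

Section Loops.
Variables (V n m xb mb mc : nat).
Hypothesis V_gt0 : 1 < V.
Local Notation runs := (runs V).
Local Notation state w cnt cur sz nxt y o :=
  (regs w [:: 0; 1; 2; n; m; cnt; cur; xb; mb; mc; sz; nxt; y] o).

Lemma run_skip_loop a w cur sz nxt y o :
  size a <= V -> all (leq^~ V) a ->
  runs skip_loop (state (a ++ w) (size a) cur sz nxt y o)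
    (state w 0 cur sz nxt (last y a) o) (5 * size a + 1).
Proof.
elim: a y => [|x a IHa] y /= aV; first by move=> _; apply: runs_while_false.
case/andP=> xV all_aV; loop_body.
- by rewrite subn1 /=; apply: IHa => //; lia.
- by [].
- by lia.
Qed.

Lemma run_iota_loop w cnt cur sz nxt y o : cur + cnt <= V ->
  runs iota_loop (state w cnt cur sz nxt y o)
    (state w 0 (cur + cnt) sz nxt y (o ++ iota cur cnt)) (7 * cnt + 1).
Proof.
elim: cnt cur o => [|cnt IH] cur o curV.
  by rewrite addn0 cats0; apply: runs_while_false.
loop_body.
- by rewrite subn1 addn1 /=; apply: IH; lia.
- by rewrite addSnnS -catA.
- by lia.
Qed.

Lemma run_mid_loop w cnt cur sz nxt y o : cur + cnt <= V ->
  runs mid_loop (state w cnt cur sz nxt y o)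
    (state w 0 (cur + cnt) sz nxt y (o ++ mid_codes cur cnt)) (10 * cnt + 1).
Proof.
elim: cnt cur o => [|cnt IH] cur o curV.
  by rewrite addn0 cats0; apply: runs_while_false.
loop_body.
- by rewrite subn1 addn1 /=; apply: IH; lia.
- by rewrite addSnnS -!catA.
- by lia.
Qed.

Lemma run_elt_loop w cnt cur sz nxt y o : cur + 2 * cnt <= V -> cnt <= V ->
  runs elt_loop (state w cnt cur sz nxt y o)
    (state w 0 (cur + 2 * cnt) sz nxt y (o ++ elt_codes cur cnt)) (10 * cnt + 1).
Proof.
elim: cnt cur o => [|cnt IH] cur o curV cntV.
  by rewrite addn0 cats0; apply: runs_while_false.
loop_body.
- by rewrite subn1 !addn1 /=; apply: IH; lia.
- by rewrite mulnS addnA addn2 -!catA.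
- by lia.
Qed.

Lemma run_member_loop s w cnt cur y o :
  all (fun x => xb + 2 * x + 1 <= V) s -> size s <= V -> cur < V ->
  exists y',
  runs member_loop (state (s ++ w) cnt cur (size s) cur.+1 y o)
    (state w cnt cur 0 cur.+1 y' (o ++ member_codes xb cur s)) (15 * size s + 1).
Proof.
move=> + + curV.
elim: s y o => [|x s IHs] y o /=.
  by move=> _ _; exists y; rewrite cats0; apply: runs_while_false.
case/andP=> xV all_sV sV.
have [||y' IH] := IHs (xb + 2 * x).+1 (o ++ [:: cur; xb + 2 * x; cur.+1; (xb + 2 * x).+1]).
- by [].
- by lia.
exists y'; loop_body.
- have -> : (size s).+1 - 1 = size s by lia.
  have -> : x + x + xb = xb + 2 * x by lia.
  by rewrite addn1 -!catA; exact: IH.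
- by rewrite /member_codes /= -catA.
- by lia.
Qed.

Lemma run_set_loop ss w cur sz nxt y o :
  all (fun s => (size s <= V) && all (fun x => xb + 2 * x + 1 <= V) s) ss ->
  xb + 2 * n + 1 <= V -> cur + 2 * size ss <= V -> size ss <= V ->
  exists sz' nxt' y',
  runs set_loop
    (state (flatten [seq size s :: s | s <- ss] ++ w) (size ss) cur sz nxt y o)
    (state w 0 (cur + 2 * size ss) sz' nxt' y' (o ++ set_codes n xb cur ss))
    (40 * size ss + 15 * size (flatten ss) + 1).
Proof.
move=> + nV; elim: ss cur sz nxt y o => [|s ss IHss] cur sz nxt y o /=.
  move=> _ _ _; exists sz, nxt, y.
  by rewrite cats0 addn0; apply: runs_while_false.
case/andP=> /andP[sV all_sV] ssV curV szV.
have [y1 mem_run] : exists y1,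
  runs (If SZ member_loop (block (Add Y N ZERO :: emit_elt)))
    (state (s ++ flatten [seq size s :: s | s <- ss] ++ w) (size ss).+1 cur
       (size s) cur.+1 y (o ++ [:: 0; cur; 1; cur.+1]))
    (state (flatten [seq size s :: s | s <- ss] ++ w) (size ss).+1 cur 0 cur.+1 y1
       (o ++ [:: 0; cur; 1; cur.+1] ++ member_codes xb cur (pad n s)))
    (15 * size s + 20).
  case: s sV all_sV => [|x s] sV all_sV.
    exists (n + n + xb + 1); eapply runs_weaken.
    - by apply: runs_if_false => //; steps.
    - rewrite /pad /member_codes /= -!catA /= addn0 !addn1.
      by have -> : n + n + xb = xb + 2 * n by lia.
    - by [].
  have [|y1 mem_run] := @run_member_loop (x :: s) (flatten [seq size s :: s | s <- ss] ++ w)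
     (size ss).+1 cur y (o ++ [:: 0; cur; 1; cur.+1]) all_sV sV.
    by lia.
  exists y1; eapply runs_weaken.
  - by apply: runs_if_true mem_run.
  - by rewrite catA.
  - by rewrite /=; lia.
have [||sz' [nxt' [y' IH]]] := IHss cur.+2 0 cur.+1 y1
   (o ++ [:: 0; cur; 1; cur.+1] ++ member_codes xb cur (pad n s)) ssV.
- by lia.
- by lia.
exists sz', nxt', y'; eapply runs_weaken.
- eapply runs_while_true; [by [] | by rewrite /=; lia | | exact: IH].
  rewrite /block [foldr _ _ _]/= -catA; do 6 step.
  eapply runs_seq.
    rewrite addn1 -!catA /=.
    exact: mem_run.
  do 2 step. rewrite addn2 subn1 /=; apply: runs_skip.
- by rewrite -!catA mulnS addnA addn2.
- by rewrite size_cat; lia.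
Qed.

End Loops.

Lemma init_regs w k : init w = regs w (nseq k 0) [::].
Proof. by congr State; apply/funext=> i; rewrite nth_nseq if_same. Qed.

Definition output_codes (n : nat) (ss : seq (seq nat)) : seq nat :=
  let m := size ss in
  graph_order n m :: iota 0 (graph_order n m) ++ (2 * m + 2 * n + 4) ::
  mid_codes (2 * m + 2 * n + 4) (4 * m).+2 ++ elt_codes (2 * m + 2) n.+1 ++
  set_codes n (2 * m + 2) 2 ss.

Lemma run_reduction_prog n (ss : seq (seq nat)) :
  all (fun s => (size s <= n) && all (ltn^~ n) s) ss ->
  exists2 s, out s = output_codes n ss &
  runs (graph_order n (size ss)) reduction_prog
    (init (n :: iota 0 n ++ size ss :: flatten [seq size s :: s | s <- ss])) s
    (200 * (n + size ss + size (flatten ss) + 1)).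
Proof.
move=> ssn; set m := size ss; set V := graph_order n m.
have VE : V = 6 * m + 2 * n + 6 by [].
have V1 : 1 < V by lia.
pose xb := 2 * m + 2; pose mb := 2 * m + 2 * n + 4; pose mc := (4 * m).+2.
set w := flatten _.
(* The last loop is treated first, since its final scratch values must be in scope before the final
   state becomes an existential variable. The value [last 0 (iota 0 n)] is what [skip_loop] leaves
   in [Y]. *)
have [||||sz [nxt [y set_run]]] :=
  @run_set_loop V n m xb mb mc V1 ss [::] 2 0 0 (last 0 (iota 0 n))
    ([:: V] ++ iota 0 V ++ [:: mb] ++ mid_codes mb mc ++ elt_codes xb n.+1).
- apply/allP=> s /(allP ssn) /andP[sn /allP sln]; apply/andP; split; first by lia.
  by apply/allP=> x /sln /= xn; rewrite /xb; lia.
- by rewrite /xb; lia.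
- by rewrite -/m; lia.
- by rewrite -/m; lia.
eexists; last first.
  rewrite (init_regs _ 13) /reduction_prog /block /=.
  eapply runs_weaken.
  - do 4 step.
    eapply runs_seq.
      rewrite addn0 -[in X in regs _ X](size_iota 0 n).
      apply: run_skip_loop => //.
      + by rewrite size_iota; lia.
      + by apply/allP=> x; rewrite mem_iota; lia.
    rewrite size_iota.
    do 10 step.
    have -> : m + m + 2 = xb by rewrite /xb; lia.
    have -> : n + n + 2 + xb = mb by rewrite /xb /mb; lia.
    have -> : m + m + (m + m) + 2 = mc by rewrite /mc; lia.
    have -> : mb + mc = V by rewrite /mc /mb VE; lia.
    step.
    eapply runs_seq; first by apply: run_iota_loop.
    do 3 step; rewrite !addn0.
    eapply runs_seq; first by apply: run_mid_loop => //; rewrite /mb /mc; lia.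
    do 2 step; rewrite addn0 addn1.
    eapply runs_seq; first by apply: run_elt_loop => //; rewrite /xb; lia.
    do 2 step; rewrite !addn0.
    eapply runs_seq; last exact: runs_skip.
    rewrite -[w]cats0 -!catA /=; exact: set_run.
  - by [].
  - by rewrite size_iota -/m VE /mc; lia.
by rewrite /output_codes /= -!catA /= -!catA.
Qed.

(** * The program prints the encoding of the graph, in quasilinear time *)

Lemma flatten_map_flatten (A B C : Type) (g : B -> seq C) (h : A -> seq B) s :
  flatten (map g (flatten (map h s))) = flatten [seq flatten (map g (h u)) | u <- s].
Proof. by elim: s => //= u s IHs; rewrite map_cat flatten_cat IHs. Qed.

Lemma map_enum_ord (A : Type) (f : nat -> A) k :
  [seq f (val i) | i <- enum 'I_k] = map f (iota 0 k).
Proof. by rewrite (map_comp f val) val_enum_ord. Qed.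

Lemma elt_codesE cur k : elt_codes cur k =
  flatten [seq [:: cur + 2 * x; (cur + 2 * x).+1] | x <- iota 0 k].
Proof.
elim: k cur => //= k IHk cur; rewrite addn0 IHk (iotaDl 1) -map_comp.
congr [:: _, _ & flatten _]; apply: eq_map => x /=.
by have -> : cur.+2 + 2 * x = cur + 2 * (1 + x) by lia.
Qed.

Lemma set_codesE n xb cur ss : set_codes n xb cur ss =
  flatten [seq [:: 0; cur + 2 * i; 1; (cur + 2 * i).+1] ++
               member_codes xb (cur + 2 * i) (pad n (nth [::] ss i))
          | i <- iota 0 (size ss)].
Proof.
elim: ss cur => //= s ss IHss cur; rewrite addn0 IHss (iotaDl 1) -map_comp.
congr [:: _, _, _, _ & _ ++ flatten _]; apply: eq_map => i /=.
by have -> : cur.+2 + 2 * i = cur + 2 * (1 + i) by lia.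
Qed.

Lemma map_padded n (s : seq 'I_n) : map val (padded s) = pad n (map val s).
Proof. by case: s => //= x s; rewrite -map_comp. Qed.

Lemma encode_family_graph (R : realType) (c : R) (F : set_family c) :
  encode_vgraph (family_graph F) =
  output_codes (fam_n F) (map (map val) (fam_sets F)).
Proof.
rewrite /encode_vgraph /output_codes size_map.
set n := fam_n F; set m := size _.
congr (_ :: _ ++ _ :: _); first exact: addn0.
rewrite [vg_edges _]/= /vedges -map_comp /edges !map_cat !flatten_cat; congr (_ ++ _ ++ _).
- rewrite /mid_edges flatten_map_flatten /= /mid_codes -[2 * m + _ + 4 in RHS]addn0 iotaDl.
  rewrite -map_comp -(map_enum_ord _ (4 * m).+2); congr flatten.
- rewrite elt_codesE -(map_enum_ord (fun x => [:: 2 * m + 2 + 2 * x; (2 * m + 2 + 2 * x).+1])).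
  rewrite /elt_edges -map_comp; congr flatten; apply: eq_map => x /=.
  by rewrite addn0 addn1.
- rewrite set_codesE size_map /set_edges flatten_map_flatten -/m.
  rewrite -(map_enum_ord (fun i => [:: 0; 2 + 2 * i; 1; (2 + 2 * i).+1] ++
    member_codes (2 * m + 2) (2 + 2 * i)
      (pad n (nth [::] (map (map val) (fam_sets F)) i)))).
  congr flatten; apply: eq_map => i.
  rewrite -map_comp flatten_map_flatten /= (nth_map [::]) // -map_padded.
  have -> : 2 * i.+1 = 2 + 2 * i by lia.
  rewrite !addn0 !addn1; congr [:: _, _, _, _ & _].
  rewrite /member_codes -!map_comp; congr flatten; apply: eq_map => x /=.
  have -> : 2 * i.+1 = 2 + 2 * i by lia.
  by rewrite !addn0 !addn1.
Qed.

Lemma size_flatten_blocks (ss : seq (seq nat)) :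
  size (flatten [seq size s :: s | s <- ss]) = size ss + size (flatten ss).
Proof. by elim: ss => //= s ss IHss; rewrite !size_cat IHss; lia. Qed.

Lemma size_leq_bitsize w : size w <= bitsize w.
Proof. by rewrite /bitsize -sum1_size; apply: leq_sum. Qed.

Lemma encode_familyE (R : realType) (c : R) (F : set_family c) :
  let ss := map (map val) (fam_sets F) in
  encode_family F = fam_n F :: iota 0 (fam_n F) ++ size ss ::
    flatten [seq size s :: s | s <- ss].
Proof.
rewrite /encode_family /= size_map -map_comp; congr (_ :: _ ++ _ :: flatten _).
by apply: eq_map => s; rewrite /= size_map.
Qed.

(** The factor 16 adds 4 to the logarithm and [bitlen] adds 1; as the logarithm is at least 1, these
    5 are absorbed. *)
Lemma bitlen_mul16 s : 1 < s -> bitlen (16 * s) <= 6 * trunc_log 2 s.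
Proof.
move=> s1; have l1 : 0 < trunc_log 2 s by rewrite trunc_log_gt0.
suff : trunc_log 2 (16 * s) = 4 + trunc_log 2 s by rewrite /bitlen => ->; lia.
have -> : 16 * s = 2 * (2 * (2 * (2 * s))) by lia.
by rewrite !trunc_logMp //; lia.
Qed.

Lemma family_graph_quasilinear (R : realType) (c : R) :
  @quasilinear_time (BigTwoDisjointSets c) BetweennessCentralityVertex
    (@family_graph R c).
Proof.
(* There are at most [200 * S] accesses, each to a number at most [16 * S] and so of cost at most
   [6 * trunc_log 2 S]; this needs [S] to be at least 2. *)
exists reduction_prog, 1200, 1, 2 => F.
set ss := map (map val) (fam_sets F).
have ssn : all (fun s => (size s <= fam_n F) && all (ltn^~ (fam_n F)) s) ss.
  apply/allP=> _ /mapP[s sF ->]; rewrite size_map; apply/andP; split; last first.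
    by apply/allP => _ /mapP[x _ ->] /=.
  have /card_uniqP <- := allP (fam_lists_uniq F) s sF.
  by rewrite -[X in _ <= X]card_ord max_card.
have [s sout [t ct tk]] := run_reduction_prog ssn.
have encE := encode_familyE F; rewrite /= -/ss in encE; rewrite -encE in ct.
exists t; first by exists s; rewrite ?sout -?encode_family_graph.
rewrite expn1 => I2.
set S := isize _ in I2 *.
(* The left side is the number of entries of the encoding, and each has at least one digit. *)
have szS : fam_n F + size ss + size (flatten ss) + 2 <= S.
  apply: leq_trans (size_leq_bitsize (encode_family F)).
  by rewrite encE /= size_cat size_iota /= size_flatten_blocks; lia.
apply: leq_trans tk _.
apply: (@leq_trans (200 * S * bitlen (16 * S))).
  apply: leq_mul; first by lia.
  by apply: leq_bitlen; rewrite /graph_order; lia.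
rewrite (_ : 1200 * _ = 200 * S * (6 * trunc_log 2 S)); last by lia.
by apply: leq_mul => //; apply: bitlen_mul16.
Qed.

(** * The output function in linear time *)

Definition threshold_prog : cmd := block
  [:: Read 0; Read 1; Read 2; Defs.Sub 3 1 2;
      If 3 (Const 4 1) (Const 4 0); Print 4].

(** The truncated difference of numerator and denominator is nonzero exactly when the numerator is
    larger. A constant number of accesses is made, each costing at most the length of the longer of
    the two. *)
Lemma exceeds1_linear (R : realType) (c : R) :
  @linear_time (BigTwoDisjointSets c) BetweennessCentralityVertex exceeds1.
Proof.
exists threshold_prog, 20 => q.
set a := absz (numq q); set d := absz (denq q); pose V := maxn a d.
(* This makes [V] at least 1, so that it also bounds the sign bit. *)
have d_gt0 : 0 < d by rewrite absz_gt0 denq_eq0.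
have aV : a <= V by rewrite leq_maxl.
have dV : d <= V by rewrite leq_maxr.
have [s [[t ct tk] sE]] : exists s, runs V threshold_prog (init (encode_rat q)) s 20 /\
    out s = encode_bool (exceeds1 q).
  eexists; split.
    rewrite (init_regs _ 5) /encode_rat -/a -/d /threshold_prog /block /=.
    eapply runs_weaken.
    - eapply runs_seq; first by apply: runs_read; case: (_ < _)%R; lia.
      do 3 step.
      eapply runs_seq.
        (* Both branches must end in one common state, which has to be given before the comparison
           is split. *)
        instantiate (2 := regs [::] [:: _; _; _; _; nat_of_bool (d < a)] [::]).
        case: (ltnP d a) => da.
          by apply: runs_if_true; rewrite /=; [lia|lia|exact: runs_const].
        apply: runs_if_false; rewrite /=; [lia|exact: runs_const].
      step; exact: runs_skip.
    - by [].
    - by [].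
  by [].
exists t; first by exists s.
apply: leq_trans tk _; rewrite leq_mul2l /= /bitsize !big_cons big_nil addn0 -/a -/d.
apply: leq_trans (leq_addl _ _); rewrite /V; case: (leqP a d) => _.
  exact: leq_addl.
exact: leq_addr.
Qed.

Theorem theorem5 (R : realType) (c : R) (hc : (0 < c)%R) :
  ql_reduces (BigTwoDisjointSets c) BetweennessCentralityVertex.
Proof.
exists (@family_graph R c); split; first exact: family_graph_quasilinear.
exists exceeds1; split; first exact: exceeds1_linear.
exact: family_graph_correct.
Qed.
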